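(* Let $n$, $m$, $t$ be positive integers and let $k = mt$, where each prime divisor of $k$ also divides $t$. If $\mathrm{BH}(n,k)$ is nonempty, then $\mathrm{BH}(mn, t)$ is nonempty.
   Context: For positive integers $n,k$, $\mathrm{BH}(n,k)$ denotes the set of $n\times n$ Butson-Hadamard matrices: $n \times n$ complex matrices $H$ all of whose entries are complex $k^{\text{th}}$ roots of unity and which satisfy $HH^* = nI_n$, where $H^*$ is the conjugate transpose of $H$ and $I_n$ is the $n\times n$ identity matrix. *)

(* Defs.v *)
From mathcomp Require Import all_boot all_order all_algebra.
From mathcomp Require Import spectral.
From mathcomp Require Import complex.
From mathcomp Require Import classical_sets reals.

Set Implicit Arguments.
Unset Strict Implicit.
Unset Printing Implicit Defensive.

Import GRing.Theory Num.Theory.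
Local Open Scope ring_scope.
Local Open Scope sesquilinear_scope.
Local Open Scope classical_set_scope.

(* H ^t* is the conjugate transpose; C is meant to be R[i] with R : realType. *)
Definition BH (C : numClosedFieldType) (n k : nat) : set 'M[C]_n :=
  [set H : 'M[C]_n |
    (forall i j, k.-unity_root (H i j)) /\ H *m H ^t* = n%:R%:M].

Arguments BH : clear implicits.

(* Main.v *)
(** It suffices to remove from [k] one prime factor at a time, so let [k = m * t]
    with [m] dividing [t], and let [z] be a primitive [k]-th root of unity.  Since
    the prime divisors of [k] divide [t], every [z -> z ^+ (1 + l * t)] is a Galois
    conjugation, hence a vanishing sum of powers of [z] splits into vanishing sums
    according to the residues of the exponents mod [m].  So replacing [z] in [H] by
    the [m x m] monomial matrix of multiplication by [z] over the field of [t]-th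
    roots of unity preserves the orthogonality of the rows; multiplying each block
    by the Fourier matrix of order [m] then fills in the zero entries. *)

Require Import Defs.
From mathcomp Require Import all_boot all_order all_algebra all_solvable all_field.
From mathcomp Require Import ring.
From mathcomp Require Import complex.
From mathcomp Require Import classical_sets reals.

Import GRing.Theory Num.Theory.

Local Open Scope complex_scope.
Local Open Scope classical_set_scope.

Section RootsOfUnity.
Local Open Scope ring_scope.
Variable C : numClosedFieldType.
Implicit Type z : C.

Lemma conjC_unity_root (k : nat) z :
  (0 < k)%N -> z ^+ k = 1 -> z^* = z^-1.
Proof.
move=> k_gt0 zk1; rewrite invC_norm; suff -> : `|z| = 1.
  by rewrite expr1n invr1 mul1r.
apply/eqP; rewrite -(@pexpr_eq1 _ _ k) ?normr_ge0 //.
by rewrite -normrX zk1 normr1.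
Qed.

Lemma sum_expr_unity_root (m : nat) z :
  z ^+ m = 1 -> \sum_(l < m) z ^+ l = if z == 1 then m%:R else 0.
Proof.
move=> zm1; case: eqP => [->|/eqP z_neq1].
  by under eq_bigr do rewrite expr1n; rewrite sumr_const card_ord.
apply: (mulfI (x := z - 1)); first by rewrite subr_eq0.
by rewrite -subrX1 zm1 subrr mulr0.
Qed.

(** Some factor ['Phi_d] of ['X^k - 1] vanishes at [z]; since it divides ['X^d - 1], the order [k]
    of [z] divides [d]. *)
Lemma root_Cyclotomic_prim (k : nat) z :
  k.-primitive_root z -> root (map_poly intr 'Phi_k) z.
Proof.
move=> prim_z; have k_gt0 := prim_order_gt0 prim_z.
have map_Xn1 n : map_poly intr ('X^n - 1 : {poly int}) = 'X^n - 1 :> {poly C}.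
  by rewrite rmorphB rmorph1 /= map_polyXn.
have: root (map_poly intr ('X^k - 1 : {poly int})) z.
  rewrite map_Xn1 -[root _ _]/(k.-unity_root z); apply/unity_rootP.
  exact: prim_expr_order.
rewrite -prod_Cyclotomic // rmorph_prod rootE horner_prod prodf_seq_eq0.
case/hasP=> d; rewrite -dvdn_divisors //= => d_dv_k Phi_d_z.
suff k_dv_d : (k %| d)%N by have/eqP-> : k == d by rewrite eqn_dvd k_dv_d.
have d_gt0 := dvdn_gt0 k_gt0 d_dv_k.
rewrite (prim_order_dvd prim_z) -unity_rootE.
rewrite -[_.-unity_root _]/(root _ z) -map_Xn1.
rewrite -prod_Cyclotomic // (big_rem d) -?dvdn_divisors //= rmorphM.
by rewrite rootM [root _ z]Phi_d_z.
Qed.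

(** A root of ['Phi_k] of order [d != k] would also be a root of ['Phi_d], against the separability
    of ['X^k - 1]. *)
Lemma numClosed_prim_root_exists (k : nat) :
  (0 < k)%N -> exists z, k.-primitive_root z.
Proof.
move=> k_gt0; pose P d : {poly C} := map_poly intr 'Phi_d.
have Xk1 : 'X^k - 1 = P k * \prod_(d <- rem k (divisors k)) P d.
  have -> : 'X^k - 1 = map_poly intr ('X^k - 1 : {poly int}) :> {poly C}.
    by rewrite rmorphB rmorph1 /= map_polyXn.
  rewrite -prod_Cyclotomic // rmorph_prod (big_rem k) //=.
  by rewrite -dvdn_divisors.
have [|z Pkz] := closed_rootP (P k) _.
  rewrite size_map_poly_id0 ?(monicP (Cyclotomic_monic k)) ?oner_eq0 //.
  by rewrite size_Cyclotomic eqSS -lt0n totient_gt0.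
exists z; have zk1 : z ^+ k = 1.
  by apply/unity_rootP;
  rewrite -[_.-unity_root _]/(root _ z) Xk1 rootM Pkz.
have [d prim_z d_dv_k] := prim_order_exists k_gt0 zk1.
have [<- //|d_neq_k] := eqVneq d k.
have : separable_poly ('X^k - 1 : {poly C}).
  by rewrite separable_Xn_sub_1 // pnatr_eq0 -lt0n.
rewrite Xk1 separable_mul => /and3P[_ _ /coprimep_root/(_ Pkz)/negP[]].
rewrite horner_prod prodf_seq_eq0; apply/hasP; exists d => /=.
  by rewrite mem_rem_uniq ?divisors_uniq // inE d_neq_k -dvdn_divisors.
exact: root_Cyclotomic_prim.
Qed.

(* The Galois conjugation [z -> z ^+ s] of the cyclotomic field. *)
Lemma root_prim_conj (k s : nat) z (q : {poly rat}) :
  k.-primitive_root z -> coprime s k ->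
  root (map_poly ratr q) z -> root (map_poly ratr q) (z ^+ s).
Proof.
move=> prim_z co_sk qz0; have k_gt0 := prim_order_gt0 prim_z.
pose Phi : {poly rat} := map_poly intr 'Phi_k.
have PhiE (F : numFieldType) :
  map_poly ratr Phi = map_poly intr 'Phi_k :> {poly F}.
  by rewrite -map_poly_comp; apply: eq_map_poly => a /=; rewrite ratr_int.
have Phi_prim (w : C) : k.-primitive_root w -> root (map_poly ratr Phi) w.
  by move=> prim_w; rewrite PhiE root_Cyclotomic_prim.
(* Irreducibility of [Phi] comes from minimal polynomials in [algC]. Non-coprimality over the
   rationals carries the common root of [Phi] and [q] from [C] to [algC], as [w]. *)
have [x prim_x] := C_prim_root_exists k_gt0.
have [w Phi_w q_w] : exists2 w : algC, root (map_poly ratr Phi) w &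
    root (map_poly ratr q) w.
  have : ~~ coprimep Phi q.
    apply/negP; rewrite -(coprimep_map (@ratr C)) => /coprimep_root.
    by move=> /(_ z (Phi_prim z prim_z))/negP; apply.
  rewrite -(coprimep_map (@ratr algC)) /coprimep => /closed_rootP[w].
  by rewrite root_gcd => /andP[]; exists w.
have prim_w : k.-primitive_root w.
  by rewrite -(root_cyclotomic prim_x) -(Cintr_Cyclotomic prim_x) -PhiE.
have [p [Dp _] dv_p] := minCpolyP w.
have Dp_Phi : p = Phi.
  apply: (map_poly_inj (@ratr algC)); rewrite -Dp (minCpoly_cyclotomic prim_w).
  by rewrite PhiE (Cintr_Cyclotomic prim_w).
(* So [Phi] divides [q], and [z ^+ s], again primitive, is a root of [Phi]. *)
move: q_w; rewrite dv_p Dp_Phi -(dvdp_map (@ratr C)) => /dvdpP[g ->].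
by rewrite rootM Phi_prim ?orbT // prim_root_exp_coprime.
Qed.

Lemma sum_prim_conj (k s : nat) z (J : finType) (d : J -> nat) :
  k.-primitive_root z -> coprime s k ->
  \sum_j z ^+ d j = 0 -> \sum_j z ^+ (s * d j) = 0.
Proof.
move=> prim_z co_sk sum0; pose q : {poly rat} := \sum_j 'X^(d j).
have qE (w : C) : (map_poly ratr q).[w] = \sum_j w ^+ d j.
  rewrite /q rmorph_sum horner_sum; apply: eq_bigr => j _.
  by rewrite /= map_polyXn hornerXn.
under eq_bigr do rewrite exprM; rewrite -qE; apply/eqP.
by apply: root_prim_conj prim_z co_sk _; rewrite rootE qE sum0.
Qed.

(* The conjugates fixing the [t]-th roots of unity are [z -> z ^+ (1 + l * t)];
   averaging them against the characters of Z/m isolates the residue [r]. *)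
Lemma sum_prim_residue (m t : nat) z (J : finType) (d : J -> nat) (r : nat) :
  (m %| t)%N -> (m * t)%N.-primitive_root z -> \sum_j z ^+ d j = 0 ->
  \sum_(j | d j == r %[mod m]) z ^+ d j = 0.
Proof.
move=> m_dv_t prim_z sum0; have := prim_order_gt0 prim_z.
rewrite muln_gt0 => /andP[m_gt0 t_gt0].
have prim_w : m.-primitive_root (z ^+ t).
  by have := dvdn_prim_root prim_z (dvdn_mulr t (dvdnn m)); rewrite mulKn.
apply: (mulfI (x := m%:R)); first by rewrite pnatr_eq0 -lt0n.
(* [s] represents [- r] modulo [m]. *)
rewrite mulr0; pose s := (m.-1 * r)%N.
transitivity (\sum_(l < m) z ^+ (t * s * l) * \sum_j z ^+ ((1 + l * t) * d j)).
  under [RHS]eq_bigr do rewrite big_distrr /=.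
  rewrite exchange_big big_distrr big_mkcond /=; apply: eq_bigr => j _.
  transitivity (z ^+ d j * \sum_(l < m) ((z ^+ t) ^+ (s + d j)) ^+ l); last first.
    rewrite big_distrr; apply: eq_bigr => l _ /=.
    by rewrite -!exprM -!exprD; congr (_ ^+ _); ring.
  rewrite sum_expr_unity_root; last first.
    by rewrite exprAC (prim_expr_order prim_w) expr1n.
  rewrite -(prim_order_dvd prim_w) -(eqn_modDl s).
  have -> : (s + r = r * m)%N by rewrite /s addnC -mulSn prednK // mulnC.
  rewrite modnMl -/(dvdn m _).
  by case: (m %| _)%N; rewrite ?mulr0 // mulrC.
rewrite big1 // => l _; rewrite (@sum_prim_conj (m * t)) ?mulr0 //.
have co_t : coprime (1 + l * t) t.
  by rewrite coprime_sym addnC /coprime gcdnMDl gcdn1.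
by rewrite coprimeMr co_t (coprime_dvdr m_dv_t).
Qed.

End RootsOfUnity.

Section Descent.
Local Open Scope ring_scope.
Variable C : numClosedFieldType.

Lemma BHP (n k : nat) (H : 'M[C]_n) :
  (0 < k)%N ->
  BH C n k H <-> (forall i j, H i j ^+ k = 1) /\
    (forall i i', \sum_j H i j / H i' j = (n * (i == i'))%:R).
Proof.
move=> k_gt0; split=> [[Hk HH]|[Hk HH]].
  have {}Hk i j : H i j ^+ k = 1 by apply/unity_rootP.
  split=> // i i'; have /matrixP/(_ i i') := HH.
  rewrite !mxE -mulrnA => <-; apply: eq_bigr => j _.
  by rewrite !mxE (@conjC_unity_root _ k).
split; first by move=> i j; apply/unity_rootP.
apply/matrixP => i i'; rewrite !mxE -mulrnA -HH.
by apply: eq_bigr => j _; rewrite !mxE (@conjC_unity_root _ k).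
Qed.

(* With [H i j = z ^+ e i j], the witness is the product [W (1 %x F)], where [W] is
   obtained from [H] by substituting for [z] its monomial matrix in the basis
   [1, z, .., z ^+ m.-1], and [F] is the Fourier matrix of order [m]. *)
Lemma BH_descent (n m t : nat) :
  (0 < m)%N -> (0 < t)%N -> (m %| t)%N ->
  BH C n (m * t)%N !=set0 -> BH C (m * n)%N t !=set0.
Proof.
move=> m_gt0 t_gt0 m_dv_t [H]; have k_gt0 : (0 < m * t)%N by rewrite muln_gt0 m_gt0.
case/(BHP _ _ _ k_gt0) => Hk HH.
have [z prim_z] := @numClosed_prim_root_exists C _ k_gt0.
have z_neq0 : z != 0 by rewrite (prim_root_eq0 prim_z) -lt0n.
have prim_w : m.-primitive_root (z ^+ t).
  by have := dvdn_prim_root prim_z (dvdn_mulr t (dvdnn m)); rewrite mulKn.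
pose e i j : nat := sval (prim_rootP prim_z (Hk i j)).
have He i j : H i j = z ^+ e i j by rewrite /e; case: prim_rootP.
have [g gK Kg] := curry_mxvec_bij m n.
have {}gK : cancel (uncurry (@mxvec_index m n)) g by move=> x; apply: gK.
have {}Kg : cancel g (uncurry (@mxvec_index m n)) by move=> x; apply: Kg.
(* [z ^+ u] is the basis element of index [u %% m] times [z ^+ (m * (u %/ m))], a [t]-th root of
   unity. The Fourier entry may use [u] for [u %% m], as [z ^+ t] has order [m]. *)
pose f (u b : nat) : C := z ^+ (m * (u %/ m)) * (z ^+ t) ^+ (u * b).
pose G := \matrix_(x, y) f ((g x).1 + e (g x).2 (g y).2)%N (g y).1.
exists G; apply/(BHP _ _ _ t_gt0); split=> [x y|x x'].
  rewrite mxE /f exprMn -!exprM.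
  apply/eqP; rewrite -exprD -(prim_order_dvd prim_z) dvdn_add //.
    by rewrite mulnAC dvdn_mulr.
  case/dvdnP: m_dv_t => c ->; apply/dvdnP.
  by exists (c * ((g x).1 + e (g x).2 (g y).2) * (g y).1)%N; ring.
rewrite (reindex (uncurry (@mxvec_index m n))) /=; last by exists g => y _.
under eq_bigr do rewrite !mxE gK.
rewrite -(can_eq Kg); case: (g x) (g x') => a i [a' i'] /=.
rewrite -(pair_bigA _ (fun (b : 'I_m) (j : 'I_n) =>
  f (a + e i j)%N b / f (a' + e i' j)%N b)) /= exchange_big /=.
(* Orthogonality of the Fourier rows: only equal basis indices contribute. *)
have sum_f u u' : \sum_(b < m) f u b / f u' b =
    if u == u' %[mod m] then m%:R * (z ^+ u / z ^+ u') else 0.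
  transitivity (z ^+ (m * (u %/ m)) / z ^+ (m * (u' %/ m)) *
      \sum_(b < m) ((z ^+ t) ^+ u / (z ^+ t) ^+ u') ^+ b).
    rewrite big_distrr; apply: eq_bigr => b _ /=.
    by rewrite /f invfM mulrACA exprMn exprVn !(exprM (z ^+ t)).
  rewrite sum_expr_unity_root; last first.
    by rewrite exprMn exprVn (exprAC _ u m) (exprAC _ u' m)
      (prim_expr_order prim_w) !expr1n divr1.
  have -> : ((z ^+ t) ^+ u / (z ^+ t) ^+ u' == 1) = (u == u' %[mod m]).
    rewrite -(eq_prim_root_expr prim_w) -subr_eq0 -[1](divff (x := (z ^+ t) ^+ u')).
      by rewrite -mulrBl mulf_eq0 invr_eq0 !expf_eq0 (negPf z_neq0)
        !andbF orbF subr_eq0.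
    by rewrite !expf_neq0.
  case: eqP => [uu'|_]; last by rewrite mulr0.
  rewrite mulrC {2}(divn_eq u m) {2}(divn_eq u' m) uu' !(mulnC _ m) !exprD.
  by rewrite invfM mulrACA divff ?mulr1 // expf_neq0.
under eq_bigr do rewrite sum_f; rewrite -big_mkcond -big_distrr /=.
rewrite xpair_eqE andbC.
(* Within one block row the congruence reduces to [a = a'], both being less than [m]. *)
have [<-|i'i] /= := eqVneq i i'.
  have cond j : (a + e i j == a' + e i j %[mod m]) = (a == a').
    by rewrite eqn_modDr !modn_small.
  under eq_bigl do rewrite cond.
  have [<-|a'a] := eqVneq a a'; last by rewrite big_pred0_eq mulr0 muln0.
  under eq_bigr do rewrite divff ?expf_neq0 //.
  by rewrite sumr_const card_ord muln1 natrM.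
(* Predecessors encode negation: [d j] represents [e i j - e i' j] modulo [m * t], and
   [a' + m.-1 * a] below represents [a' - a] modulo [m]. *)
rewrite muln0; pose d j := (e i j + (m * t).-1 * e i' j)%N.
have zd j : z ^+ d j = z ^+ e i j / z ^+ e i' j.
  apply: (mulIf (x := z ^+ e i' j)); first by rewrite expf_neq0.
  rewrite divfK ?expf_neq0 // -exprD -addnA -mulSnr prednK //.
  by rewrite exprD exprM (prim_expr_order prim_z) expr1n mulr1.
have sum_d : \sum_j z ^+ d j = 0.
  under eq_bigr do rewrite zd -!He; rewrite HH.
  by rewrite (negPf i'i) muln0.
have := @sum_prim_residue C m t z _ d (a' + m.-1 * a) m_dv_t prim_z sum_d.
have cond j : (d j == a' + m.-1 * a %[mod m]) = (a + e i j == a' + e i' j %[mod m]).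
  rewrite -(eqn_modDr (a + e i' j)).
  have -> : (d j + (a + e i' j) = (t * e i' j) * m + (a + e i j))%N.
    transitivity (a + e i j + (m * t).-1.+1 * e i' j)%N; first by rewrite /d; ring.
    by rewrite prednK //; ring.
  have -> : (a' + m.-1 * a + (a + e i' j) = a * m + (a' + e i' j))%N.
    transitivity (a * m.-1.+1 + (a' + e i' j))%N; first by ring.
    by rewrite prednK.
  by rewrite !modnMDl.
rewrite (eq_bigl _ _ cond) => residue0.
under eq_bigr do rewrite !exprD invfM mulrACA -zd.
by rewrite -big_distrr /= residue0 !mulr0.
Qed.

End Descent.

Theorem theorem1p2 (R : realType) (n m t k : nat)
    (n_gt0 : (0 < n)%N) (m_gt0 : (0 < m)%N) (t_gt0 : (0 < t)%N)
    (def_k : k = (m * t)%N)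
    (prime_k_t : forall p : nat, prime p -> (p %| k)%N -> (p %| t)%N) :
  BH R[i] n k !=set0 -> BH R[i] (m * n)%N t !=set0.
Proof.
rewrite {}def_k in prime_k_t *.
elim/ltn_ind: m n m_gt0 prime_k_t {n_gt0} => m IHm n m_gt0 prime_t.
have [m_le1|m_gt1] := leqP m 1.
  have -> : m = 1%N by apply/eqP; rewrite eqn_leq m_le1.
  by rewrite !mul1n.
have p_pr := pdiv_prime m_gt1; have p_gt0 := prime_gt0 p_pr.
have p_dv_t : (pdiv m %| t)%N by rewrite prime_t ?dvdn_mulr ?pdiv_dvd.
have [q Dm] := dvdnP (pdiv_dvd m).
move: (pdiv m) Dm p_pr p_gt0 p_dv_t => p Dm p_pr p_gt0 p_dv_t.
have q_gt0 : (0 < q)%N by case: q Dm m_gt0 => // ->.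
have -> : (m * t = p * (q * t))%N by rewrite Dm mulnCA mulnA.
(* One descent removes [p] and turns [n] into [p * n]; induction then removes [q]. *)
move=> /BH_descent-/(_ p_gt0) H; rewrite Dm -mulnA; apply: IHm => //.
- by rewrite Dm ltn_Pmulr ?prime_gt1.
- by move=> r r_pr r_dv; rewrite prime_t // Dm mulnAC dvdn_mulr.
- by apply: H; rewrite ?muln_gt0 ?q_gt0 // dvdn_mull.
Qed.
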